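(* Let $\mathfrak{B}$ be a unital $C^*$-algebra with unit $I_{\mathfrak{B}}$, and let $A\in\mathfrak{B}$ be self-adjoint with $A^2-A\ge 0$. Let $\mathfrak{A}=M_2(\mathfrak{B})$, regarded as a Hilbert module over itself, let $\ell(A)=(A^2-A)^{1/2}\in\mathfrak{B}$, and let $P,Q\in\mathfrak{A}$ be defined by $$P=\begin{pmatrix} I_{\mathfrak{B}} & 0\\ 0 & 0\end{pmatrix},\quad Q=\begin{pmatrix} A & -\ell(A)\\ \ell(A) & I_{\mathfrak{B}}-A\end{pmatrix}.$$ Then $(P,Q)$ is harmonious if and only if $$I_{\mathfrak{B}}\in\overline{\mathcal{R}(A^2-A)}+\mathcal{N}(A^2-A),$$ where $\mathcal{R}(A^2-A)=\{(A^2-A)x:x\in\mathfrak{B}\}$ and $\mathcal{N}(A^2-A)=\{x\in\mathfrak{B}:(A^2-A)x=0\}$.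
   Context: For a unital $C^*$-algebra $\mathfrak{C}$, $\mathfrak{C}$ is a right Hilbert $\mathfrak{C}$-module with inner product $\langle x,y\rangle=x^*y$, and $\mathfrak{C}$ is identified with the algebra $\mathcal{L}(\mathfrak{C})$ of adjointable operators on it via $b\mapsto L_b$, $L_b(x)=bx$. This is applied to $\mathfrak{C}=\mathfrak{A}=M_2(\mathfrak{B})$ (the $2\times2$ matrices over $\mathfrak{B}$), so $P,Q\in\mathfrak{A}$ are viewed as operators on the Hilbert $\mathfrak{A}$-module $\mathscr{H}=\mathfrak{A}$, with identity operator $I$. The bar denotes norm closure; for an operator $T$, $\mathcal{R}(T)$ denotes its range. For a Hilbert $C^*$-module $\mathscr{H}$, a closed submodule $\mathscr{M}$ is orthogonally complemented in $\mathscr{H}$ if $\mathscr{H}=\mathscr{M}+\mathscr{M}^\perp$. A quasi-projection pair $(P,Q)$ on $\mathscr{H}$ consists of a projection $P$ (self-adjoint idempotent) and an idempotent $Q$ in $\mathcal{L}(\mathscr{H})$ such that $PQ^*P=PQP$, $PQ^*(I-P)=-PQ(I-P)$ and $(I-P)Q^*(I-P)=(I-P)Q(I-P)$; equivalently, $Q^*=(2P-I)Q(2P-I)$. A quasi-projection pair $(P,Q)$ is harmonious if both $\overline{\mathcal{R}(PQ(I-P))}$ and $\overline{\mathcal{R}((I-P)QP)}$ are orthogonally complemented in $\mathscr{H}$. The pair $(P,Q)$ in the claim is a quasi-projection pair on $\mathfrak{A}$. *)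

(* Defs.v *)
From HB Require Import structures.
From mathcomp Require Import all_boot all_order all_algebra.
From mathcomp Require Import all_real_closed.
From mathcomp Require Import all_classical all_reals all_analysis.

Set Implicit Arguments.
Unset Strict Implicit.
Unset Printing Implicit Defensive.

Import Order.TTheory GRing.Theory Num.Theory.
Import numFieldNormedType.Exports.

Local Open Scope classical_set_scope.
Local Open Scope ring_scope.
Local Open Scope complex_scope.

(* Complex unital C*-algebras, the complex field being [R[i]] for
   [R : realType].  The norm of a [normedModType R[i]] takes its values in
   [R[i]] (they are real and nonnegative).  The ring structure is derived from
   [cs_mul] and [cs_one] below: the hierarchy has no join of normed modules
   and noncommutative rings that could be extended here.  The zero algebra is
   included. *)
HB.mixin Record isUnitalCStar (R : realType) B
    of CompleteNormedModule R[i] B := {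
  cs_one : B ;
  cs_mul : B -> B -> B ;
  cs_mulA : associative cs_mul ;
  cs_mul1l : left_id cs_one cs_mul ;
  cs_mul1r : right_id cs_one cs_mul ;
  cs_mulDl : left_distributive cs_mul +%R ;
  cs_mulDr : right_distributive cs_mul +%R ;
  cs_scaleAl : forall (z : R[i]) (x y : B),
    z *: cs_mul x y = cs_mul (z *: x) y ;
  cs_scaleAr : forall (z : R[i]) (x y : B),
    z *: cs_mul x y = cs_mul x (z *: y) ;
  star : B -> B ;
  starK : involutive star ;
  starD : {morph star : x y / x + y} ;
  starZ : forall (z : R[i]) (x : B), star (z *: x) = z^* *: star x ;
  star_cs_mul : forall x y : B, star (cs_mul x y) = cs_mul (star y) (star x) ;
  cs_normM : forall x y : B, `|cs_mul x y| <= `|x| * `|y| ;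
  cs_normC : forall x : B, `|cs_mul (star x) x| = `|x| ^+ 2
}.

#[short(type="cstarType")]
HB.structure Definition UnitalCStar (R : realType) :=
  {B of CompleteNormedModule R[i] B & isUnitalCStar R B}.

HB.instance Definition _ (R : realType) (B : cstarType R) :=
  GRing.Zmodule_isPzRing.Build (UnitalCStar.sort B) (@cs_mulA R B)
    (@cs_mul1l R B) (@cs_mul1r R B) (@cs_mulDl R B) (@cs_mulDr R B).

Section CStarTheory.
Context {R : realType} {B : cstarType R}.
Implicit Types x y : B.

Lemma starM x y : star (x * y) = star y * star x.
Proof. exact: star_cs_mul. Qed.

Lemma cstar_scalerAl (z : R[i]) x y : z *: (x * y) = (z *: x) * y.
Proof. exact: cs_scaleAl. Qed.

Lemma cstar_scalerAr (z : R[i]) x y : z *: (x * y) = x * (z *: y).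
Proof. exact: cs_scaleAr. Qed.

Lemma cstar_normM x y : `|x * y| <= `|x| * `|y|.
Proof. exact: cs_normM. Qed.

Lemma cstar_norm x : `|star x * x| = `|x| ^+ 2.
Proof. exact: cs_normC. Qed.

End CStarTheory.

Section CStarElements.
Context {R : realType} {B : cstarType R}.
Implicit Types a b : B.

Definition selfadjoint a := star a = a.

Definition invertible a := exists b, b * a = 1 /\ a * b = 1.

Definition spectrum a : set R[i] := [set z | ~ invertible (a - z *: (1 : B))].

(* In the order of [R[i]], [0 <= z] says that [z] is real and nonnegative. *)
Definition cstar_nonneg a :=
  selfadjoint a /\ (forall z, spectrum a z -> 0 <= z).

(* The positive square root; it is only meaningful if [cstar_nonneg a], in
   which case exactly one [b] is as specified. *)
Definition cstar_sqrt a : B :=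
  xget 0 [set b | cstar_nonneg b /\ b * b = a].

Definition nullspace a : set B := [set x | a * x = 0].

End CStarElements.

Section MatrixCStar.
Context {R : realType} {B : cstarType R}.

Definition mx22 (a b c d : B) : 'M[B]_2 :=
  \matrix_(i, j) if i == 0 then (if j == 0 then a else b)
                           else (if j == 0 then c else d).

Definition mx_star n (T : 'M[B]_n) : 'M[B]_n := \matrix_(i, j) star (T j i).

(* The inner product and the norm of the right Hilbert B-module B^n. *)
Definition cv_inner n (x y : 'cV[B]_n) : B := \sum_i star (x i 0) * y i 0.

Definition cv_norm n (x : 'cV[B]_n) : R :=
  Num.sqrt (complex.Re `|cv_inner x x|).

(* The C*-norm of M_n(B), as the operator norm on B^n.  It is not the norm
   that the library puts on matrices (the maximum of the entry norms). *)
Definition mx_cnorm n (T : 'M[B]_n) : R :=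
  sup [set cv_norm (T *m x) | x in [set x : 'cV[B]_n | cv_norm x <= 1]].

End MatrixCStar.

(* A unital C*-algebra as a right Hilbert module over itself, given by its
   ring [A], its involution [adj] and its norm [nrm].  An element [a] of [A]
   stands for the adjointable operator [x |-> a * x], of adjoint
   [x |-> adj a * x]; the norm of the Hilbert module is [nrm], because
   [nrm (adj x * x) = nrm x ^+ 2]. *)
Section SelfHilbertModule.
Context {R : realType} {A : pzRingType}.
Variables (adj : A -> A) (nrm : A -> R).
Implicit Types (a p q x y : A) (M : set A).

Definition hm_inner x y : A := adj x * y.

Definition hm_closure M : set A :=
  [set x | forall e : R, 0 < e -> exists2 y, M y & nrm (x - y) < e].

Definition hm_orth M : set A := [set x | forall y, M y -> hm_inner x y = 0].

Definition orth_complemented M :=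
  [set x + y | x in M & y in hm_orth M] = [set: A].

Definition op_range a : set A := range (fun x => a * x).

Definition is_projection p := adj p = p /\ p * p = p.

Definition quasi_projection_pair p q :=
  [/\ is_projection p,
      q * q = q,
      p * adj q * p = p * q * p,
      p * adj q * (1 - p) = - (p * q * (1 - p)) &
      (1 - p) * adj q * (1 - p) = (1 - p) * q * (1 - p)].

Definition harmonious p q :=
  [/\ quasi_projection_pair p q,
      orth_complemented (hm_closure (op_range (p * q * (1 - p)))) &
      orth_complemented (hm_closure (op_range ((1 - p) * q * p)))].

End SelfHilbertModule.

(* Main.v *)
Require Import Defs.
From mathcomp Require Import all_boot all_order all_algebra.
From mathcomp Require Import all_real_closed.
From mathcomp Require Import all_classical all_reals all_analysis.
From mathcomp Require Import ring lra.

(** Put [a = A ^+ 2 - A] and let [l] be its positive square root.  The block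
    product [P * Q * (1 - P)] has the single nonzero entry [- l], and
    [(1 - P) * Q * P] the single nonzero entry [l].  The closure of the range
    of such a matrix consists of the matrices whose entries in one row lie in
    the closure of [l B] and whose other row vanishes, and its orthogonal
    complement asks the entries of that row to be killed by [l]
    ([orth_complemented_entry_mx]).  So both ranges are complemented exactly
    when [B] is the sum of the closure of [l B] and of the null space of [l].
    These two sets are right ideals, hence it is enough to decompose the unit,
    and they do not change when [l] is replaced by [a = l * l]
    ([range_complemented_sq]): the C*-identity handles the null space, and
    [l * l * (l * (l * l + t ^ 2)^-1)] tends to [l] as [t] tends to [0].

    What remains is C*-algebra theory from the axioms, obtained here without
    holomorphic or continuous functional calculus.

    The spectral radius theorem is needed for self-adjoint [h] only:
    [nrm h <= r] as soon as [h - t] is invertible for all real [t] with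
    [r < `|t|] ([sa_norm_le]).  Suppose [nrm h = 1] and [1 - h], [1 + h] are
    invertible.  Then [1 - z h] has an inverse that is bounded on the circle
    [`|z| = 1], so for some [q < 1] the inverses of [1 - z h] and of
    [1 - z q h] are within [1/4] of each other on the whole circle.  The
    inverse of [1 - k^2 h^2] is the mean of those of [1 - k h] and [1 + k h];
    so this closeness passes from the pair [h], [q] to the pair [h^2], [q^2],
    and by iteration to [h^(2^n)], [q^(2^n)].  When [q^(2^n)] is small, the
    inverse of [1 - h^(2^n)] is near [1], whereas [nrm (h^(2^n)) = 1] by the
    C*-identity: a contradiction.

    A self-adjoint [a] is then nonnegative exactly when [nrm (t - a) <= t] for
    some [t], which makes sums of nonnegative elements nonnegative.  A
    recursion gives a square root of [a] that commutes with everything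
    commuting with [a] ([sqrt_exists]); since the nonnegative square root is
    unique ([sqrt_unique]), [l] commutes with [A], which is what makes [Q]
    idempotent.  Finally [star x * x] is nonnegative ([nonneg_star_mul]), so
    the norm of a column dominates the norms of its entries and convergence in
    the C*-norm of matrices is entrywise convergence ([hm_closureP]). *)

Set Implicit Arguments.
Unset Strict Implicit.
Unset Printing Implicit Defensive.

Import Order.TTheory GRing.Theory Num.Theory.
Import numFieldNormedType.Exports.

Local Open Scope classical_set_scope.
Local Open Scope ring_scope.
Local Open Scope complex_scope.

Lemma subrDDl (V : zmodType) (s p q : V) : (s + p) - (s + q) = p - q.
Proof. by rewrite opprD addrACA subrr add0r. Qed.

(** * Real-valued norm, scalars and limits *)

Section RealNorm.
Context {R : realType} {B : cstarType R}.
Implicit Types (x y a b : B) (z : R[i]) (t : R).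

(** The norm of [B] takes values in [R[i]]; its real part carries all of it
    ([nrmE]) and allows estimates in the ordered field [R]. *)
Definition nrm (x : B) : R := complex.Re `|x|.

Lemma nrmE x : `|x| = (nrm x)%:C.
Proof. by rewrite /nrm RRe_real // ger0_real. Qed.

Lemma nrm_ge0 x : 0 <= nrm x.
Proof. by rewrite -ler0c -nrmE. Qed.

Lemma nrm0 : nrm 0 = 0.
Proof. by rewrite /nrm normr0. Qed.

Lemma nrm0_eq0 x : nrm x = 0 -> x = 0.
Proof. by move=> x0; apply/normr0_eq0; rewrite nrmE x0. Qed.

Lemma nrm_small_eq0 x : (forall e, 0 < e -> nrm x <= e) -> x = 0.
Proof.
move=> small; apply/nrm0_eq0/eqP; rewrite eq_le nrm_ge0 andbT.
by apply/ler_addgt0Pr => e e0; rewrite add0r small.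
Qed.

Lemma nrmN x : nrm (- x) = nrm x.
Proof. by rewrite /nrm normrN. Qed.

Lemma nrmBC x y : nrm (x - y) = nrm (y - x).
Proof. by rewrite -nrmN opprB. Qed.

Lemma nrmD x y : nrm (x + y) <= nrm x + nrm y.
Proof. by rewrite -lecR rmorphD /= -!nrmE ler_normD. Qed.

Lemma nrmB x y : nrm (x - y) <= nrm x + nrm y.
Proof. by rewrite -(nrmN y) nrmD. Qed.

Lemma nrm_tri x y w : nrm (x - w) <= nrm (x - y) + nrm (y - w).
Proof. by apply: le_trans (nrmD _ _); rewrite addrA subrK. Qed.

Lemma nrmM x y : nrm (x * y) <= nrm x * nrm y.
Proof. by rewrite -lecR rmorphM /= -!nrmE cstar_normM. Qed.

Lemma nrmZ z x : nrm (z *: x) = complex.Re `|z| * nrm x.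
Proof.
apply: complexI; rewrite rmorphM /= -!nrmE normrZ.
by [].
Qed.

Lemma Re_norm_real t : complex.Re `|t%:C| = `|t|.
Proof. by rewrite normc_def /= expr0n /= addr0 sqrtr_sqr. Qed.

Lemma nrmZr t x : nrm (t%:C *: x) = `|t| * nrm x.
Proof. by rewrite nrmZ Re_norm_real. Qed.

Lemma nrm_star_sq x : nrm (star x * x) = nrm x ^+ 2.
Proof.
by apply: complexI; rewrite rmorphXn /= -!nrmE cstar_norm.
Qed.

(** [nrm x ^+ 2 = nrm (star x * x) <= nrm (star x) * nrm x], and [star] is an
    involution. *)
Lemma nrm_star x : nrm (star x) = nrm x.
Proof.
have le_star (y : B) : nrm y <= nrm (star y).
  have [->|y0] := eqVneq (nrm y) 0; first exact: nrm_ge0.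
  have := nrmM (star y) y; rewrite nrm_star_sq expr2 ler_pM2r //.
  by rewrite lt_def y0 nrm_ge0.
by apply/eqP; rewrite eq_le le_star andbT -{2}(starK x) le_star.
Qed.

(** An inequality, because the norm of the unit is 0 in the zero algebra. *)
Lemma nrm1_le1 : nrm (1 : B) <= 1.
Proof.
have := nrm_star_sq 1; rewrite mulr1 nrm_star expr2 => h.
have [//|h1] := lerP (nrm (1 : B)) 1; nra.
Qed.

Lemma mul_scalarl z x : (z *: (1 : B)) * x = z *: x.
Proof. by rewrite -cstar_scalerAl mul1r. Qed.

Lemma mul_scalarr z x : x * (z *: (1 : B)) = z *: x.
Proof. by rewrite -cstar_scalerAr mulr1. Qed.

Lemma scalarC z x : (z *: (1 : B)) * x = x * (z *: (1 : B)).
Proof. by rewrite mul_scalarl mul_scalarr. Qed.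

Lemma nrm_scalar t : nrm (t%:C *: (1 : B)) <= `|t|.
Proof. by rewrite nrmZr ler_piMr // nrm1_le1. Qed.

Lemma star0 : star (0 : B) = 0.
Proof. by apply: (addIr (star 0)); rewrite add0r -starD addr0. Qed.

Lemma starN x : star (- x) = - star x.
Proof. by apply: (addIr (star x)); rewrite -starD !addNr star0. Qed.

Lemma starB x y : star (x - y) = star x - star y.
Proof. by rewrite starD starN. Qed.

Lemma star1 : star (1 : B) = 1.
Proof. by have := starM (star 1) (1 : B); rewrite mulr1 !starK mulr1. Qed.

Lemma starZr t x : star (t%:C *: x) = t%:C *: star x.
Proof. by rewrite starZ; congr (_ *: _); exact: conjc_real. Qed.

Lemma sa_scalar t : selfadjoint (t%:C *: (1 : B)).
Proof. by rewrite /selfadjoint starZr star1. Qed.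

Lemma saD {x y} : selfadjoint x -> selfadjoint y -> selfadjoint (x + y).
Proof. by rewrite /selfadjoint starD => -> ->. Qed.

Lemma saB {x y} : selfadjoint x -> selfadjoint y -> selfadjoint (x - y).
Proof. by rewrite /selfadjoint starB => -> ->. Qed.

Lemma saZ t {x} : selfadjoint x -> selfadjoint (t%:C *: x).
Proof. by rewrite /selfadjoint starZr => ->. Qed.

Lemma saM {x y} : selfadjoint x -> selfadjoint y -> x * y = y * x ->
  selfadjoint (x * y).
Proof. by rewrite /selfadjoint starM => -> -> ->. Qed.

Lemma nrm_sa_sq x : selfadjoint x -> nrm (x * x) = nrm x ^+ 2.
Proof. by move=> sx; rewrite -nrm_star_sq sx. Qed.

Definition converges (u : nat -> B) v :=
  forall e, 0 < e -> exists N, forall n, (N <= n)%N -> nrm (u n - v) < e.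

(** Majorant form of completeness: the increments of [u] are dominated by those
    of a bounded sequence of reals, which is nondecreasing, hence Cauchy. *)
Lemma limit_exists (u : nat -> B) (r : nat -> R) (M : R) :
  (forall n, nrm (u n.+1 - u n) <= r n.+1 - r n) -> (forall n, r n <= M) ->
  exists v, converges u v.
Proof.
move=> hu rM.
have du n k : nrm (u (n + k)%N - u n) <= r (n + k)%N - r n.
  elim: k => [|k IH]; first by rewrite addn0 !subrr nrm0.
  rewrite addnS; apply: le_trans (nrm_tri _ (u (n + k)%N) _) _.
  by have := lerD (hu (n + k)%N) IH; rewrite addrA subrK.
have ndr : {homo r : n m / (n <= m)%N >-> n <= m}.
  move=> n m /subnK <-; rewrite addnC; have := du n (m - n)%N.
  by have := nrm_ge0 (u (n + (m - n))%N - u n); lra.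
have cvr : cvgn r.
  by apply: nondecreasing_is_cvgn => //; exists M => _ [n _ <-].
have cauchy_u : cauchy (u @ \oo).
  (* a positive radius in R[i] is real, so it can be compared with nrm *)
  apply: cauchy_exP => e e0.
  have eE : e = (complex.Re e)%:C by rewrite RRe_real // gtr0_real.
  have e0' : 0 < complex.Re e by rewrite -ltcR -eE.
  have /cvgrPdist_lt /(_ _ e0') [N _ hN] := cvr.
  exists (u N); exists N => // n /= Nn.
  rewrite -ball_normE /ball_ /= nrmE eE ltcR nrmBC -(subnKC Nn).
  apply: le_lt_trans (du _ _) _; rewrite subnKC //.
  have := hN N (leqnn N); rewrite /= => h; apply: le_lt_trans h.
  rewrite ger0_norm ?lerB ?subr_ge0 //; exact: nondecreasing_cvgn_le.
have /cvgrPdist_lt uv : cvgn u by exact: cauchy_cvg cauchy_u.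
exists (lim (u @ \oo)) => e e0.
have /uv [N _ hN] : 0 < e%:C by rewrite ltcR.
by exists N => n Nn; have := hN n Nn; rewrite /= nrmE ltcR nrmBC.
Qed.

Lemma limit_unique (u : nat -> B) v w :
  converges u v -> converges u w -> v = w.
Proof.
move=> uv uw; apply/eqP; rewrite -subr_eq0; apply/eqP.
apply: nrm_small_eq0 => e e0.
have [N hN] := uv _ (divr_gt0 e0 (ltr0n _ 2)).
have [N' hN'] := uw _ (divr_gt0 e0 (ltr0n _ 2)).
have := hN _ (leq_maxl N N'); have := hN' _ (leq_maxr N N').
have := nrm_tri v (u (maxn N N')) w; rewrite (nrmBC v (u _)); lra.
Qed.

End RealNorm.

(** * Inverses and the Neumann series *)

Section Inverses.
Context {R : realType} {B : cstarType R}.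
Implicit Types (x y a b c d v w : B) (z : R[i]) (t : R).

Lemma converges_lip (u : nat -> B) v (f : B -> B) (C : R) :
  (forall n, nrm (f (u n) - f v) <= C * nrm (u n - v)) ->
  converges u v -> converges (fun n => f (u n)) (f v).
Proof.
move=> fC uv e e0; have C0 : 0 < `|C| + 1 by rewrite ltr_pwDr.
have [N hN] := uv _ (divr_gt0 e0 C0).
exists N => n /hN; rewrite ltr_pdivlMr // mulrC => h.
apply: le_lt_trans (fC n) _; apply: le_lt_trans h.
by apply: ler_wpM2r; rewrite ?nrm_ge0 //; have := ler_norm C; lra.
Qed.

Lemma converges_ext (u u' : nat -> B) v : u =1 u' -> converges u v ->
  converges u' v.
Proof. by move=> /funext <-. Qed.

Lemma convergesS (u : nat -> B) v :
  converges u v -> converges (fun n => u n.+1) v.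
Proof.
by move=> uv e /uv[N hN]; exists N => n Nn; apply: hN; apply: leq_trans Nn _.
Qed.

Lemma convergesMl a (u : nat -> B) v :
  converges u v -> converges (fun n => a * u n) (a * v).
Proof.
apply: (@converges_lip u v (GRing.mul a) (nrm a)) => n.
by rewrite -mulrBr nrmM.
Qed.

Lemma convergesMr a (u : nat -> B) v :
  converges u v -> converges (fun n => u n * a) (v * a).
Proof.
apply: (@converges_lip u v (GRing.mul^~ a) (nrm a)) => n.
by rewrite -mulrBl (le_trans (nrmM _ _)) // mulrC.
Qed.

(** The commutant of an element is closed. *)
Lemma converges_comm a (u : nat -> B) v :
  (forall n, a * u n = u n * a) -> converges u v -> a * v = v * a.
Proof.
move=> au uv; apply: limit_unique (convergesMl a uv) _.
by apply: converges_ext (convergesMr a uv) => n; rewrite au.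
Qed.

(** Two-sided inverse with an explicit witness, so that inverses can be
    estimated; [invertible a] unfolds to [exists v, isinv v a]. *)
Definition isinv v a := v * a = 1 /\ a * v = 1.

Lemma isinvM v w a b : isinv v a -> isinv w b -> isinv (w * v) (a * b).
Proof.
move=> [va av] [wb bw]; split; first by rewrite mulrA -(mulrA w) va mulr1.
by rewrite mulrA -(mulrA a) bw mulr1.
Qed.

Lemma isinvZ z v a : z != 0 -> isinv v a -> isinv (z^-1 *: v) (z *: a).
Proof.
move=> z0 [va av]; split; rewrite -cstar_scalerAl -cstar_scalerAr scalerA.
  by rewrite va mulVf ?scale1r.
by rewrite av mulfV ?scale1r.
Qed.

Lemma isinv_star v a : isinv v a -> isinv (star v) (star a).
Proof. by move=> [va av]; split; rewrite -starM ?va ?av star1. Qed.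

Lemma invertibleM a b : invertible a -> invertible b -> invertible (a * b).
Proof. by move=> [v i] [w j]; exists (w * v); apply: isinvM. Qed.

Lemma invertibleN a : invertible (- a) -> invertible a.
Proof.
by move=> [v [va av]]; exists (- v); rewrite mulNr -mulrN va mulrN -mulNr.
Qed.

Lemma invertibleZ z a : z != 0 -> invertible (z *: a) -> invertible a.
Proof.
move=> z0 [v i]; exists (z *: v).
have zV : z^-1 != 0 by rewrite invr_eq0.
by have := isinvZ zV i; rewrite scalerA mulVf // scale1r invrK.
Qed.

(** The identity behind the fact that [a * b] and [b * a] have the same nonzero
    spectrum. *)
Lemma isinv_swap v a b :
  isinv v (1 - a * b) -> isinv (1 + b * v * a) (1 - b * a).
Proof.
move=> [vab abv].
have e1 : b * v * a * (b * a) = b * v * a - b * a.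
  rewrite -(mulr1 b) -{4}vab mulr1 mulrBr mulr1 mulrBr mulrBl.
  by rewrite !mulrA opprB addrC subrK.
have e2 : b * a * (b * v * a) = b * v * a - b * a.
  rewrite -{4}(mulr1 b) -abv mulrBl mul1r mulrBr mulrBl.
  by rewrite !mulrA opprB addrC subrK.
split; first by rewrite mulrBr mulr1 mulrDl mul1r e1 (addrC (b * a)) subrK addrK.
by rewrite mulrDr mulr1 mulrBl mul1r e2 opprB (addrC (b * v * a)) subrK subrK.
Qed.

(** The partial sums of the geometric series solve [u n.+1 = 1 + x * u n]; in
    the limit [v = 1 + x * v], and [v] commutes with [x]. *)
Lemma neumann x : nrm x < 1 -> invertible (1 - x).
Proof.
set q := nrm x => q1; have q0 : 0 <= q := nrm_ge0 x.
pose u := fix u n := if n is m.+1 then 1 + x * u m else 0.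
pose r := fix r n := if n is m.+1 then 1 + q * r m else 0.
have rM n : r n <= (1 - q)^-1.
  elim: n => [|n IH] /=; first by rewrite invr_ge0 subr_ge0 ltW.
  have -> : (1 - q)^-1 = 1 + q * (1 - q)^-1 by field; lra.
  by rewrite lerD2l ler_wpM2l.
have ur n : nrm (u n.+1 - u n) <= r n.+1 - r n.
  elim: n => [|n IH]; first by rewrite /= !mulr0 !addr0 !subr0 nrm1_le1.
  change (nrm ((1 + x * u n.+1) - (1 + x * u n))
    <= (1 + q * r n.+1) - (1 + q * r n)).
  rewrite !subrDDl -!mulrBr.
  by apply: le_trans (nrmM _ _) _; rewrite ler_wpM2l.
have [v uv] := limit_exists ur rM.
have vE : v = 1 + x * v.
  apply: limit_unique (convergesS uv) _.
  apply: (@converges_lip u v (fun y => 1 + x * y) q) uv => n.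
  by rewrite subrDDl -mulrBr nrmM.
have xv : x * v = v * x.
  apply: (converges_comm _ uv); elim=> [|n IH] /=; first by rewrite mulr0 mul0r.
  by rewrite mulrDr mulrDl mulr1 mul1r IH mulrA IH.
by exists v; split; rewrite ?mulrBr ?mulrBl ?mulr1 ?mul1r -?xv {1}vE addrK.
Qed.

(** [a + d = a * (1 + v * d)], where the second factor is inverted by a Neumann
    series.  The bound comes from [w = v - w * d * v]. *)
Lemma invertible_perturb v a d : isinv v a -> nrm v * nrm d <= 2^-1 ->
  exists2 w, isinv w (a + d) & nrm w <= 2 * nrm v.
Proof.
move=> [va av] vd; have vd1 : nrm (- (v * d)) < 1.
  by rewrite nrmN; have := nrmM v d; lra.
have [w0 [w1 w2]] := neumann vd1; rewrite opprK in w1 w2.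
have adE : a + d = a * (1 + v * d) by rewrite mulrDr mulr1 mulrA av mul1r.
have wi : isinv (w0 * v) (a + d).
  rewrite adE; split; first by rewrite mulrA -(mulrA w0) va mulr1 w1.
  by rewrite mulrA -(mulrA a) w2 mulr1.
exists (w0 * v) => //; move: wi; set w := w0 * v => -[wi _].
have wE : w = v - w * d * v.
  by rewrite -{1}(mul1r v) -wi mulrDr mulrDl -mulrA av mulr1 addrK.
have := nrmB v (w * d * v); rewrite -wE; have := nrmM (w * d) v; have := nrmM w d.
have := nrm_ge0 v; have := nrm_ge0 w; have := nrm_ge0 d; move: vd.
set V := nrm v; set D := nrm d; set W := nrm w => vd D0 W0 V0 wd wdv h.
have : nrm (w * d) * V <= W * 2^-1.
  apply: le_trans (_ : W * (V * D) <= _); last by rewrite ler_wpM2l.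
  by rewrite (mulrC V) mulrA ler_wpM2r.
lra.
Qed.

End Inverses.

(** * Resolvents of self-adjoint elements *)

Section SpectralRadius.
Context {R : realType} {B : cstarType R}.
Implicit Types (x y a b c d h v w : B) (z : R[i]) (t : R).

Local Notation ii := ('i%C : R[i]).

Lemma imag_neq0 : ii != 0.
Proof. by rewrite eq_complex /= oner_eq0 andbF. Qed.

Lemma Re_norm_imag t : complex.Re `|ii * t%:C| = `|t|.
Proof.
rewrite normrM.
have -> : `|ii| = 1 by rewrite normc_def /= expr0n expr1n add0r sqrtr1.
by rewrite mul1r Re_norm_real.
Qed.

Lemma star_imag t : star ((ii * t%:C) *: (1 : B)) = - ((ii * t%:C) *: (1 : B)).
Proof.
rewrite starZ star1 -scaleNr; congr (_ *: _).
apply/eqP; rewrite eq_complex /=.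
by rewrite !(mul0r, mul1r, mulr0, add0r, addr0, subr0, sub0r, oppr0) !eqxx.
Qed.

Lemma sa_imag_prod h t : selfadjoint h ->
  (h - (ii * t%:C) *: (1 : B)) * (h + (ii * t%:C) *: (1 : B)) =
  h * h + (t ^+ 2)%:C *: (1 : B).
Proof.
move=> sh; rewrite mulrDr !mulrBl !mul_scalarr !mul_scalarl scalerA.
rewrite addrA subrK; congr (_ + _).
rewrite -scaleNr; congr (_ *: _); rewrite mulrACA -expr2 sqr_i mulN1r opprK.
by rewrite -rmorphM expr2.
Qed.

(** Arens' trick.  The square of the norm of [h + i t] is at most
    [nrm h ^+ 2 + t ^+ 2], which is less than [(t + 1) ^+ 2] for
    [t = nrm h ^+ 2]; thus [h - i = (h + i t) - i (t + 1)] is a small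
    perturbation of a nonzero scalar. *)
Lemma sa_sub_imag_invertible h : selfadjoint h -> invertible (h - ii *: (1 : B)).
Proof.
move=> sh; set t := nrm h ^+ 2; have t0 : 0 <= t by rewrite sqr_ge0.
set y := h + (ii * t%:C) *: (1 : B); set k := ii * (t + 1)%:C.
have t1 : (t + 1)%:C != 0 :> R[i] by rewrite fmorph_eq0; lra.
have k0 : k != 0 by rewrite mulf_neq0 ?imag_neq0.
have ny : nrm y ^+ 2 <= t + t ^+ 2.
  rewrite -nrm_star_sq /y starD sh star_imag sa_imag_prod //.
  apply: le_trans (nrmD _ _) _; rewrite nrm_sa_sq // lerD2l.
  by apply: le_trans (nrm_scalar _) _; rewrite ger0_norm ?sqr_ge0.
have ny1 : nrm y < t + 1.
  rewrite -(@ltr_pXn2r _ 2) ?nnegrE ?nrm_ge0 //; nra.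
have nx : nrm (k^-1 *: y) < 1.
  have -> : k^-1 = (- ii) * ((t + 1)^-1)%:C.
    rewrite /k invfM; congr (_ * _); last by rewrite fmorphV.
    apply: (mulfI imag_neq0); rewrite divff ?imag_neq0 //.
    by rewrite mulrN -expr2 sqr_i opprK.
  rewrite mulNr scaleNr nrmN nrmZ Re_norm_imag ger0_norm ?invr_ge0 //; last lra.
  by rewrite mulrC ltr_pdivrMr ?mul1r //; lra.
have [v hv] := neumann nx.
apply: invertibleN.
have -> : - (h - ii *: (1 : B)) = k *: (1 - k^-1 *: y).
  rewrite opprB scalerBr scalerA mulfV // scale1r /y /k rmorphD /= mulrDr mulr1.
  by rewrite scalerDl (addrC h) subrDDl.
by exists (k^-1 *: v); apply: isinvZ.
Qed.

(** The Cayley transform [u = (h + i) * v] is an isometry, so [nrm u <= 1], and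
    [u = 1 + 2 i v]. *)
Lemma cayley_bound h v :
  selfadjoint h -> isinv v (h - ii *: (1 : B)) -> nrm v <= 1.
Proof.
move=> sh iv; have [vh hv] := iv.
have [vh' _] := isinv_star iv; rewrite starB sh in vh'.
have si : star (ii *: (1 : B)) = - (ii *: (1 : B)).
  by have := star_imag 1; rewrite rmorph1 mulr1.
rewrite si opprK in vh'.
pose u := (h + ii *: (1 : B)) * v.
have uu : star u * u = 1.
  rewrite /u starM starD sh si.
  have comm : (h - ii *: (1 : B)) * (h + ii *: (1 : B)) =
              (h + ii *: (1 : B)) * (h - ii *: (1 : B)).
    have e : (h - ii *: (1 : B)) * h = h * (h - ii *: (1 : B)).
      by rewrite mulrBl mulrBr scalarC.
    by rewrite mulrDr e -[X in _ + X]scalarC -mulrDl.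
  by rewrite !mulrA -(mulrA _ _ (h + _)) comm !mulrA vh' mul1r hv.
have nu : nrm u <= 1.
  by rewrite -(@ler_pXn2r _ 2) ?nnegrE ?nrm_ge0 // expr1n -nrm_star_sq uu nrm1_le1.
have uE : u = 1 + (ii * 2%:C) *: v.
  have e2 : ii * 2%:C = ii + ii by rewrite rmorph_nat mulr_natr.
  have hE : h + ii *: (1 : B) = (h - ii *: (1 : B)) + (ii + ii) *: (1 : B).
    by rewrite scalerDl addrA subrK.
  by rewrite /u hE mulrDl hv mul_scalarl e2.
have : nrm ((ii * 2%:C) *: v) <= 2.
  rewrite -[_ *: v](addKr 1) -uE addrC.
  by have := nrmB u 1; have := @nrm1_le1 R B; lra.
by rewrite nrmZ Re_norm_imag ger0_norm; lra.
Qed.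

(** Translating and scaling [h] by reals reduces to [z = i]. *)
Lemma sa_resolvent_bound h z : selfadjoint h -> complex.Im z != 0 ->
  exists2 v, isinv v (h - z *: (1 : B)) & nrm v <= `|complex.Im z|^-1.
Proof.
case: z => s t /= sh t0; set k := t%:C.
have k0 : k != 0 by rewrite fmorph_eq0.
pose g := (t^-1)%:C *: (h - s%:C *: (1 : B)).
have sg : selfadjoint g by apply/saZ/saB; last exact: sa_scalar.
have [v iv] := sa_sub_imag_invertible sg.
have hE : h - (s +i* t) *: (1 : B) = k *: (g - ii *: (1 : B)).
  rewrite scalerBr !scalerA -rmorphM mulfV // rmorph1 scale1r.
  by rewrite [s +i* t]complexE /= scalerDl opprD addrA [ii * _]mulrC.
exists (k^-1 *: v); first by rewrite hE; exact: isinvZ.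
rewrite /k -fmorphV nrmZr normfV ler_piMr ?invr_ge0 //.
exact: cayley_bound iv.
Qed.

Lemma Re_norm_sqr z : complex.Re `|z| ^+ 2 = complex.Re z ^+ 2 + complex.Im z ^+ 2.
Proof. by rewrite normc_def /= sqr_sqrtr // addr_ge0 // sqr_ge0. Qed.

(** If [z] is on the right half of the unit circle and close to the real axis,
    then [z] is close to [1] ([`|1 - z| <= 2 * `|Im z|]) and [1 - z h] is a
    small perturbation of [1 - h]. *)
Lemma circle_near_one h z v (N : R) : nrm h = 1 -> isinv v (1 - h) ->
  nrm v <= N -> `|z| = 1 -> 0 <= complex.Re z ->
  N * `|complex.Im z| <= 4^-1 ->
  exists2 w, isinv w (1 - z *: h) & nrm w <= 2 * N.
Proof.
move=> h1 iv vN z1 s0 tN.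
have v0 := nrm_ge0 v.
have := Re_norm_sqr z; rewrite z1 /= expr1n => st.
have nz : nrm ((1 - z) *: h) <= 2 * `|complex.Im z|.
  rewrite nrmZ h1 mulr1 -(@ler_pXn2r _ 2) ?nnegrE ?mulr_ge0 ?nrm_ge0 //; last first.
    by rewrite normc_def /= sqrtr_ge0.
  rewrite Re_norm_sqr exprMn real_normK ?num_real //.
  case: z z1 s0 st tN => s t /= z1 s0 st tN; nra.
have [|w iw nw] := @invertible_perturb _ _ _ _ ((1 - z) *: h) iv.
  by have := nrm_ge0 ((1 - z) *: h); have := normr_ge0 (complex.Im z); nra.
exists w; last by lra.
suff -> : 1 - z *: h = 1 - h + (1 - z) *: h by [].
by rewrite scalerBl scale1r addrA subrK.
Qed.

(** The bound is explicit, so that no compactness of the circle is involved: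
    near [1] and [-1] by perturbation, elsewhere by the distance to the real
    axis. *)
Lemma sa_circle_bound h : selfadjoint h -> nrm h = 1 ->
  invertible (1 - h) -> invertible (1 + h) ->
  exists2 M, 0 <= M & forall z, `|z| = 1 ->
    exists2 v, isinv v (1 - z *: h) & nrm v <= M.
Proof.
move=> sh h1 [v iv] [w iw].
pose N := 1 + nrm v + nrm w.
have v0 := nrm_ge0 v; have w0 := nrm_ge0 w.
have N0 : 0 < N by rewrite /N; lra.
exists (4 * N); first by lra.
move=> z z1; have := Re_norm_sqr z; rewrite z1 /= expr1n => st.
have z0 : z != 0 by rewrite -normr_gt0 z1 ltr01.
(* the left half of the circle is the right half for - h and - z *)
have [tN|tN] := lerP (N * `|complex.Im z|) 4^-1.
  have [s0|s0] := lerP 0 (complex.Re z).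
    have vN : nrm v <= N by rewrite /N; lra.
    have [u iu nu] := circle_near_one h1 iv vN z1 s0 tN.
    by exists u => //; lra.
  have wN : nrm w <= N by rewrite /N; lra.
  rewrite -[h]opprK in iw.
  have s0' : 0 <= complex.Re (- z) by move: s0; case: (z) => /= *; lra.
  have tN' : N * `|complex.Im (- z)| <= 4^-1.
    by move: tN; case: (z) => /= *; rewrite normrN.
  have nh1 : nrm (- h) = 1 by rewrite nrmN.
  have nz1 : `|- z| = 1 by rewrite normrN.
  have [u iu nu] := circle_near_one nh1 iw wN nz1 s0' tN'.
  by exists u; [rewrite scaleNr scalerN opprK in iu|lra].
have zzc : z * z^-1 = 1 by rewrite mulfV.
have imz : `|complex.Im z^-1| = `|complex.Im z|.
  rewrite invc_norm z1 expr1n invr1 mul1r.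
  by case: (z) => /= *; rewrite normrN.
have t0 : 0 < `|complex.Im z|.
  by rewrite lt_def normr_ge0 andbT; apply/eqP => e; move: tN; rewrite e; lra.
have [|u iu nu] := @sa_resolvent_bound h z^-1 sh.
  by rewrite -normr_gt0 imz.
exists ((- z)^-1 *: u).
  have -> : 1 - z *: h = (- z) *: (h - z^-1 *: (1 : B)).
    by rewrite scalerBr scalerA mulNr mulfV // !scaleNr scale1r opprK addrC.
  by apply: isinvZ iu; rewrite oppr_eq0.
rewrite nrmZ normfV normrN z1 invr1 /= mul1r; apply: le_trans nu _.
rewrite imz -(@ler_pM2r _ `|complex.Im z|) // mulVf ?gt_eqF //; lra.
Qed.

End SpectralRadius.

(** * The spectral radius of a self-adjoint element *)

Section SpectralRadiusTheorem.
Context {R : realType} {B : cstarType R}.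
Implicit Types (x y a b c d h v w : B) (z : R[i]) (t : R).

(** The partial fraction decomposition of the inverse of [1 - y ^+ 2]. *)
Lemma isinv_avg v w y : isinv v (1 - y) -> isinv w (1 + y) ->
  isinv (2^-1%:C *: (v + w)) (1 - y * y).
Proof.
move=> [vy yv] [wy yw].
have e1 : 1 - y * y = (1 - y) * (1 + y).
  by rewrite mulrDr mulr1 mulrBl mul1r addrA subrK.
have e2 : 1 - y * y = (1 + y) * (1 - y).
  by rewrite mulrBr mulr1 mulrDl mul1r opprD addrA addrK.
have two : 2^-1%:C *: ((1 + y) + (1 - y)) = 1 :> B.
  rewrite addrACA subrr addr0 scalerDr -scalerDl -rmorphD /=.
  by rewrite (_ : 2^-1 + 2^-1 = 1) ?rmorph1 ?scale1r //; lra.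
split.
  by rewrite -cstar_scalerAl mulrDl {1}e1 e2 !mulrA vy wy !mul1r two.
by rewrite -cstar_scalerAr mulrDr {1}e2 e1 -!mulrA yv yw !mulr1 two.
Qed.

(** On the whole unit circle, replacing [x] by [q x] moves the inverse of
    [1 - z x] by at most [1/4].  The constant [1/4] is what
    [circle_close_small] can afford. *)
Definition circle_close x (q : R) := forall z, `|z| = 1 -> exists v w,
  [/\ isinv v (1 - z *: x), isinv w (1 - (z * q%:C) *: x) & nrm (v - w) <= 4^-1].

(** With [k] a square root of [z], the inverse at [z] for [x * x] is the mean
    of the inverses at [k] and [- k] for [x], and a mean of two differences of
    norm at most [1/4] has norm at most [1/4]. *)
Lemma circle_close_sqr x q : circle_close x q -> circle_close (x * x) (q ^+ 2).
Proof.
move=> xq z z1; set k := sqrtc z; have kk : k ^+ 2 = z by exact: sqr_sqrtc.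
have k1 : `|k| = 1.
  apply/eqP; rewrite -(@pexpr_eq1 _ _ 2) //; apply/eqP.
  by rewrite -normrX kk.
have [v [w [iv iw vw]]] := xq _ k1.
have [|v' [w' [iv' iw' vw']]] := xq (- k); first by rewrite normrN.
exists (2^-1%:C *: (v + v')), (2^-1%:C *: (w + w')); split.
- rewrite (_ : z *: (x * x) = (k *: x) * (k *: x)).
    by apply: isinv_avg => //; rewrite scaleNr opprK in iv'.
  by rewrite -cstar_scalerAl -cstar_scalerAr scalerA -(expr2 k) kk.
- rewrite (_ : _ *: (x * x) = ((k * q%:C) *: x) * ((k * q%:C) *: x)).
    by apply: isinv_avg => //; rewrite mulNr scaleNr opprK in iw'.
  by rewrite -cstar_scalerAl -cstar_scalerAr scalerA -(expr2 (k * _)) exprMn kk rmorphXn.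
rewrite -scalerBr nrmZr ger0_norm; last by lra.
by rewrite opprD addrACA; have := nrmD (v - w) (v' - w'); lra.
Qed.

(** At [z = 1], the inverse [w] of [1 - q x] is within [1/7] of [1], so the
    inverse [v] of [1 - x] is within [1/4 + 1/7 < 1/2] of [1].  From
    [x = (v - 1) - x * (v - 1)] this contradicts [nrm x = 1]. *)
Lemma circle_close_small x q : circle_close x q -> 0 <= q -> q <= 8^-1 ->
  nrm x = 1 -> Logic.False.
Proof.
move=> xq q0 q8 x1; have [|v [w [[_ iv] [_ iw] vw]]] := xq 1; first by rewrite normr1.
rewrite scale1r in iv; rewrite mul1r in iw.
have wE : w - 1 = q%:C *: x + (q%:C *: x) * (w - 1).
  rewrite mulrBr mulr1 [RHS]addrC subrK.
  by move: iw; rewrite mulrBl mul1r => <-; rewrite opprB addrC subrK.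
have nw : nrm (w - 1) <= 7^-1.
  have := nrmD (q%:C *: x) ((q%:C *: x) * (w - 1)); rewrite -wE.
  have := nrmM (q%:C *: x) (w - 1); rewrite nrmZr x1 mulr1 ger0_norm //.
  have := nrm_ge0 (w - 1); nra.
have nv : nrm (v - 1) <= 2^-1 - 20^-1.
  by have := nrm_tri v w 1; lra.
have vE : v - 1 = x * v.
  by move: iv; rewrite mulrBl mul1r => <-; rewrite opprB addrC subrK.
have xE : x = (v - 1) - x * (v - 1).
  by rewrite mulrBr mulr1 {1}vE opprB addrC subrK.
have := nrmB (v - 1) (x * (v - 1)); rewrite -xE.
have := nrmM x (v - 1); rewrite x1; lra.
Qed.

Lemma sa_spectral_radius1 h : selfadjoint h -> nrm h = 1 ->
  invertible (1 - h) -> invertible (1 + h) -> Logic.False.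
Proof.
move=> sh h1 ih ih'; have [M M0 hM] := sa_circle_bound sh h1 ih ih'.
(* c = 1 - q; perturbation by z c h needs M c <= 1/2, and the difference of the
   inverses, at most M * c * (2 M), has to be at most 1/4 *)
pose c := (8 * (M + 1) ^+ 2)^-1.
have c8 : c * (8 * (M + 1) ^+ 2) = 1 by rewrite mulVf //; nra.
have c0 : 0 < c by rewrite invr_gt0; nra.
have cM : M * c <= 8^-1 by nra.
have cMM : M * M * c <= 8^-1 by nra.
have c18 : c <= 8^-1 by nra.
have close : circle_close h (1 - c).
  move=> z z1; have [v iv nv] := hM z z1; exists v.
  have nd : nrm ((z * c%:C) *: h) = c.
    by rewrite nrmZ h1 mulr1 normrM z1 mul1r Re_norm_real gtr0_norm.
  have v0 := nrm_ge0 v.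
  have [|w iw nw] := @invertible_perturb _ _ _ _ ((z * c%:C) *: h) iv.
    by rewrite nd; nra.
  have hE : 1 - (z * (1 - c)%:C) *: h = 1 - z *: h + (z * c%:C) *: h.
    by rewrite rmorphB rmorph1 mulrBr mulr1 scalerBl opprB addrCA addrC.
  exists w; split; rewrite ?hE //.
  have -> : v - w = v * ((z * c%:C) *: h) * w.
    have [_ iw2] := iw; have [iv1 _] := iv.
    have e : v * (1 - z *: h + (z * c%:C) *: h) * w = v.
      by rewrite -mulrA iw2 mulr1.
    by rewrite -{1}e mulrDr iv1 mulrDl mul1r addrC addKr.
  have := nrmM (v * ((z * c%:C) *: h)) w; have := nrmM v ((z * c%:C) *: h).
  rewrite nd; have w0 := nrm_ge0 w.
  set p := nrm (v * _); have : 0 <= p by exact: nrm_ge0.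
  move=> p0 pv pw; apply: le_trans pw _.
  have : p * nrm w <= (M * c) * (2 * M) by apply: ler_pM => //; nra.
  by nra.
(* x n is h^(2^n) *)
pose x n := iter n (fun y => y * y) h.
have xP n : [/\ selfadjoint (x n), nrm (x n) = 1 &
    circle_close (x n) ((1 - c) ^+ (2 ^ n))].
  elim: n => [|n [sx nx cx]]; first by rewrite expn0 expr1.
  split => /=; first exact: saM.
    by rewrite nrm_sa_sq // nx expr1n.
  by rewrite expnS mulnC exprM; exact: circle_close_sqr.
have q1 : `|1 - c| < 1 by rewrite ger0_norm; lra.
have e8 : (0 : R) < 8^-1 by lra.
have /cvgrPdist_lt /(_ _ e8) [N _ hN] := cvg_expr q1.
have [_ nx cx] := xP N.
apply: (circle_close_small cx _ _ nx); first by rewrite exprn_ge0 //; lra.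
have := hN (2 ^ N)%N (ltnW (ltn_expl _ _)); rewrite /= sub0r normrN.
by move=> /(_ isT) /ltW; rewrite ger0_norm // exprn_ge0 //; lra.
Qed.

(** The spectral radius theorem for self-adjoint elements: a norm larger than
    [r] could be scaled to [1], against [sa_spectral_radius1]. *)
Lemma sa_norm_le h (r : R) : selfadjoint h -> 0 <= r ->
  (forall t, r < `|t| -> invertible (h - t%:C *: (1 : B))) -> nrm h <= r.
Proof.
move=> sh r0 inv; have [//|rN] := lerP (nrm h) r; exfalso.
set N := nrm h in rN; have N0 : 0 < N by lra.
have Nc0 : N%:C != 0 :> R[i] by rewrite fmorph_eq0 gt_eqF.
have NV : N%:C * N^-1%:C = 1 :> R[i] by rewrite -rmorphM mulfV ?rmorph1 ?gt_eqF.
apply: (@sa_spectral_radius1 (N^-1%:C *: h)).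
- exact: saZ.
- by rewrite nrmZr ger0_norm ?invr_ge0 ?ltW // mulVf // gt_eqF.
- apply: (@invertibleZ _ _ N%:C) => //; apply: invertibleN.
  by rewrite scalerBr scalerA NV scale1r opprB; apply: inv; rewrite gtr0_norm.
apply: (@invertibleZ _ _ N%:C) => //.
have := inv (- N); rewrite normrN gtr0_norm // rmorphN scaleNr opprK.
by rewrite scalerDr scalerA NV scale1r addrC; apply.
Qed.

End SpectralRadiusTheorem.

(** * Nonnegative elements *)

Section Positivity.
Context {R : realType} {B : cstarType R}.
Implicit Types (x y a b c d h u v w : B) (z : R[i]) (t : R).

Lemma invertible_scalar_sub t a : nrm a < t -> invertible (t%:C *: (1 : B) - a).
Proof.
move=> at_; have t0 : 0 < t by have := nrm_ge0 a; lra.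
have tc0 : t%:C != 0 :> R[i] by rewrite fmorph_eq0 gt_eqF.
have [|v iv] := @neumann _ _ (t^-1%:C *: a).
  by rewrite nrmZr gtr0_norm ?invr_gt0 // mulrC ltr_pdivrMr // mul1r.
have -> : t%:C *: (1 : B) - a = t%:C *: (1 - t^-1%:C *: a).
  by rewrite scalerBr scalerA -rmorphM mulfV ?gt_eqF // rmorph1 scale1r.
by exists ((t%:C)^-1 *: v); exact: isinvZ.
Qed.

(** The spectrum of a self-adjoint element is real, so only negative real
    points have to be excluded. *)
Lemma nonneg_of_invertible a : selfadjoint a ->
  (forall t, 0 < t -> invertible (a + t%:C *: (1 : B))) -> cstar_nonneg a.
Proof.
move=> sa inv; split=> // z sz.
have [z0|z0] := eqVneq (complex.Im z) 0; last first.
  by have [v iv _] := sa_resolvent_bound sa z0; case: sz; exists v.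
case: z z0 sz => s t /= -> sz; rewrite complexr0 ler0c leNgt; apply/negP => s0.
by apply: sz; have := inv (- s); rewrite rmorphN scaleNr oppr_gt0; apply.
Qed.

Lemma nonneg_invertible a t : cstar_nonneg a -> 0 < t ->
  invertible (a + t%:C *: (1 : B)).
Proof.
move=> [_ sp] t0; apply: contrapT => ni.
have : 0 <= - t%:C :> R[i] by apply: sp; rewrite /spectrum /= scaleNr opprK.
by rewrite -rmorphN ler0c oppr_ge0 leNgt t0.
Qed.

(** The spectrum of [a] lies in the interval from [0] to [nrm a], hence so does
    the spectrum of [nrm a - a]. *)
Lemma nonneg_norm_sub a : cstar_nonneg a ->
  nrm ((nrm a)%:C *: (1 : B) - a) <= nrm a.
Proof.
move=> pa; have [sa _] := pa; have a0 := nrm_ge0 a.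
apply: sa_norm_le => //; first by apply: saB => //; exact: sa_scalar.
move=> t; rewrite real_ltr_normr ?num_real // => /orP[] tN.
  apply: invertibleN.
  have -> : - ((nrm a)%:C *: (1 : B) - a - t%:C *: (1 : B)) =
            a + (t - nrm a)%:C *: (1 : B).
    by rewrite rmorphB scalerBl !opprB addrCA addrC -addrA.
  by apply: nonneg_invertible => //; lra.
have -> : (nrm a)%:C *: (1 : B) - a - t%:C *: (1 : B) =
          (nrm a - t)%:C *: (1 : B) - a.
  by rewrite rmorphB scalerBl addrAC.
by apply: invertible_scalar_sub; lra.
Qed.

(** Together with [nonneg_norm_sub], this characterizes nonnegativity by the
    norm, in a form that is stable under sums. *)
Lemma nonneg_of_norm_sub a t : selfadjoint a ->
  nrm (t%:C *: (1 : B) - a) <= t -> cstar_nonneg a.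
Proof.
move=> sa ta; apply: nonneg_of_invertible => // s s0.
have -> : a + s%:C *: (1 : B) =
          (t + s)%:C *: (1 : B) - (t%:C *: (1 : B) - a).
  by rewrite rmorphD scalerDl opprB [RHS]addrC addrA subrK.
by apply: invertible_scalar_sub; lra.
Qed.

Lemma nonnegD a b : cstar_nonneg a -> cstar_nonneg b -> cstar_nonneg (a + b).
Proof.
move=> pa pb; have [sa _] := pa; have [sb _] := pb.
apply: (@nonneg_of_norm_sub _ (nrm a + nrm b)); first exact: saD.
rewrite rmorphD scalerDl opprD addrACA; apply: le_trans (nrmD _ _) _.
by apply: lerD; exact: nonneg_norm_sub.
Qed.

Lemma nonnegZ t a : 0 <= t -> cstar_nonneg a -> cstar_nonneg (t%:C *: a).
Proof.
move=> t0 pa; have [sa _] := pa.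
apply: (@nonneg_of_norm_sub _ (t * nrm a)); first exact: saZ.
rewrite rmorphM -scalerA -scalerBr nrmZr ger0_norm // ler_wpM2l //.
exact: nonneg_norm_sub.
Qed.

(** [x * x + s ^ 2 = (x - i s) * (x + i s)]. *)
Lemma nonneg_sq x : selfadjoint x -> cstar_nonneg (x * x).
Proof.
move=> sx; apply: nonneg_of_invertible; first exact: saM.
move=> t t0; rewrite -(sqr_sqrtr (ltW t0)) -sa_imag_prod //.
set k := 'i%C * _.
have k0 : complex.Im k != 0.
  by rewrite /= mul0r mul1r add0r gt_eqF // sqrtr_gt0.
have k0' : complex.Im (- k) != 0 by move: k0; case: (k) => /= *; rewrite oppr_eq0.
have [v iv _] := sa_resolvent_bound sx k0.
have [w iw _] := sa_resolvent_bound sx k0'.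
rewrite scaleNr opprK in iw.
by apply: invertibleM; [exists v|exists w].
Qed.

Lemma nonneg_antisym u : cstar_nonneg u -> cstar_nonneg (- u) -> u = 0.
Proof.
move=> pu pNu; have [su _] := pu; apply/nrm0_eq0/eqP.
rewrite eq_le nrm_ge0 andbT; apply: sa_norm_le => // t.
rewrite normr_gt0; case: (ltgtP t 0) => // t0 _.
  by have := @nonneg_invertible _ (- t) pu; rewrite rmorphN scaleNr oppr_gt0; apply.
by apply: invertibleN; rewrite opprB addrC; exact: nonneg_invertible.
Qed.

Lemma nonneg_le_norm a t :
  cstar_nonneg a -> cstar_nonneg (t%:C *: (1 : B) - a) -> 0 <= t -> nrm a <= t.
Proof.
move=> pa pta t0; have [sa _] := pa; apply: sa_norm_le => // s.
rewrite real_ltr_normr ?num_real // => /orP[] st.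
  apply: invertibleN.
  have -> : - (a - s%:C *: (1 : B)) =
            (t%:C *: (1 : B) - a) + (s - t)%:C *: (1 : B).
    by rewrite opprB rmorphB scalerBl [RHS]addrC addrA subrK.
  by apply: nonneg_invertible => //; lra.
by have := @nonneg_invertible _ (- s) pa; rewrite rmorphN scaleNr; apply; lra.
Qed.

(** With [t = nrm (u + v)] the element [t - u = (t - (u + v)) + v] is
    nonnegative, so the spectrum of [u] lies between [0] and [t]. *)
Lemma nonneg_norm_leD u v : cstar_nonneg u -> cstar_nonneg v ->
  nrm u <= nrm (u + v).
Proof.
move=> pu pv; apply: nonneg_le_norm => //; last exact: nrm_ge0.
have puv := nonnegD pu pv; have [suv _] := puv.
rewrite -[X in cstar_nonneg (_ - X)](addrK v) opprB addrCA.
apply: nonnegD => //; apply: (@nonneg_of_norm_sub _ (nrm (u + v))).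
  by apply: saB => //; exact: sa_scalar.
by rewrite opprB addrC subrK.
Qed.

End Positivity.

(** * Square roots and nonnegativity of star x * x *)

Section SquareRoot.
Context {R : realType} {B : cstarType R}.
Implicit Types (x y a b c d g l u v w : B) (z : R[i]) (t : R).

(** [y = 1 - (1 - x)^(1/2)] is the limit of [u n.+1 = (x + u n ^+ 2) / 2].  The
    increments are dominated by those of the same recursion [r] over the reals
    with [x = 1], which stays below [1]. *)
Lemma sqrt_iteration x : selfadjoint x -> nrm x <= 1 ->
  exists y, [/\ selfadjoint y, nrm y <= 1, y + y = x + y * y &
    forall c, c * x = x * c -> c * y = y * c].
Proof.
move=> sx x1.
pose u := fix u n := if n is m.+1 then 2^-1%:C *: (x + u m * u m) else 0.
pose r := fix r n : R := if n is m.+1 then 2^-1 * (1 + r m * r m) else 0.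
have rP n : 0 <= r n /\ r n <= 1.
  elim: n => [|n [IH0 IH1]]; first by rewrite /= lexx ler01.
  have : 0 <= r n * r n <= 1 by rewrite mulr_ge0 ?mulr_ile1.
  by rewrite /=; move: (r n * r n) => p /andP[p0 p1]; split; lra.
have half0 : `|2^-1 : R| = 2^-1 by rewrite ger0_norm //; lra.
have un n : nrm (u n) <= r n.
  elim: n => [|n IH]; first by rewrite nrm0.
  rewrite nrmZr half0 ler_wpM2l //.
  apply: le_trans (nrmD _ _) _; apply: lerD => //.
  apply: le_trans (nrmM _ _) _; apply: ler_pM => //; exact: nrm_ge0.
have sqB p q : p * p - q * q = p * (p - q) + (p - q) * q.
  by rewrite mulrBr mulrBl addrA subrK.
have ur n : nrm (u n.+1 - u n) <= r n.+1 - r n.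
  elim: n => [|n IH].
    rewrite /= !mulr0 !addr0 !subr0 mulr1 nrmZr half0.
    by have := nrm_ge0 x; lra.
  change (nrm (2^-1%:C *: (x + u n.+1 * u n.+1) - 2^-1%:C *: (x + u n * u n))
    <= 2^-1 * (1 + r n.+1 * r n.+1) - 2^-1 * (1 + r n * r n)).
  rewrite -scalerBr subrDDl nrmZr half0 -mulrBr ler_wpM2l //.
  rewrite subrDDl sqB; apply: le_trans (nrmD _ _) _.
  have -> : r n.+1 * r n.+1 - r n * r n =
    r n.+1 * (r n.+1 - r n) + (r n.+1 - r n) * r n by ring.
  apply: lerD; apply: le_trans (nrmM _ _) _; apply: ler_pM => //; exact: nrm_ge0.
have [|y uy] := limit_exists ur (M := 1); first by move=> n; have [] := rP n.
have yE : y = 2^-1%:C *: (x + y * y).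
  apply: limit_unique (convergesS uy) _.
  pose f w : B := 2^-1%:C *: (x + w * w).
  apply: (@converges_lip _ _ u y f (1 + nrm y)) uy => n.
  rewrite -scalerBr subrDDl nrmZr half0 sqB.
  have := nrmD (u n * (u n - y)) ((u n - y) * y).
  have := nrmM (u n) (u n - y); have := nrmM (u n - y) y.
  have := un n; have [] := rP n; have := nrm_ge0 (u n - y); have := nrm_ge0 y.
  have := nrm_ge0 (u n); nra.
exists y; split.
- rewrite /selfadjoint; apply: (limit_unique _ uy).
  suff su n : star (u n) = u n.
    move=> e /uy[N hN]; exists N => n /hN.
    by rewrite -nrm_star starB su.
  elim: n => [|n IH] /=; first exact: star0.
  by rewrite starZr starD starM sx IH.
- apply/ler_addgt0Pr => e /uy[N /(_ N (leqnn N))].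
  have := nrm_tri y (u N) 0; rewrite !subr0 (nrmBC y).
  by have := un N; have [] := rP N; lra.
- by rewrite {1 2}yE -scalerDl -rmorphD /= (_ : 2^-1 + 2^-1 = 1) ?rmorph1 ?scale1r //; lra.
- move=> c cx; apply: (converges_comm _ uy).
  elim=> [|n IH] /=; first by rewrite mulr0 mul0r.
  rewrite -cstar_scalerAr -cstar_scalerAl; congr (_ *: _).
  by rewrite mulrDr mulrDl cx mulrA IH -mulrA IH mulrA.
Qed.

Lemma nonneg0 : cstar_nonneg (0 : B).
Proof. by have := @nonneg_sq R B 0 star0; rewrite mulr0. Qed.

(** The iteration is applied to [x = 1 - a / nrm a], whose norm is at most [1]
    because [a] is nonnegative. *)
Lemma sqrt_exists a : cstar_nonneg a -> exists b,
  [/\ cstar_nonneg b, b * b = a & forall c, c * a = a * c -> c * b = b * c].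
Proof.
move=> pa; have [sa _] := pa.
have [a0|a0] := eqVneq (nrm a) 0.
  exists 0; split; first exact: nonneg0.
    by rewrite mulr0 (nrm0_eq0 a0).
  by move=> c _; rewrite mulr0 mul0r.
set N := nrm a in a0; have N0 : 0 < N by rewrite lt_def a0 nrm_ge0.
pose x := 1 - N^-1%:C *: a.
have NV : N%:C * N^-1%:C = 1 :> R[i] by rewrite -rmorphM mulfV ?rmorph1.
have sx : selfadjoint x by apply: saB; [exact: star1|exact: saZ].
have nx : nrm x <= 1.
  have -> : x = N^-1%:C *: (N%:C *: (1 : B) - a).
    by rewrite scalerBr scalerA mulrC NV scale1r.
  rewrite nrmZr gtr0_norm ?invr_gt0 // mulrC ler_pdivrMr // mul1r.
  exact: nonneg_norm_sub.
have [y [sy ny yy yc]] := sqrt_iteration sx nx.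
have py : cstar_nonneg (1 - y).
  apply: (@nonneg_of_norm_sub _ _ _ 1); first by apply: saB => //; exact: star1.
  by rewrite rmorph1 scale1r opprB addrC subrK.
exists ((Num.sqrt N)%:C *: (1 - y)); split.
- by apply: nonnegZ => //; exact: sqrtr_ge0.
- rewrite -cstar_scalerAl -cstar_scalerAr scalerA -rmorphM -expr2 sqr_sqrtr ?ltW //.
  have -> : (1 - y) * (1 - y) = 1 - x.
    rewrite mulrBr mulr1 mulrBl mul1r opprB addrACA -opprD yy.
    by rewrite opprD addrACA subrr addr0.
  by rewrite opprB addrC subrK scalerA NV scale1r.
move=> c ca; rewrite -cstar_scalerAr -cstar_scalerAl; congr (_ *: _).
rewrite mulrBr mulrBl mulr1 mul1r yc //.
by rewrite mulrBr mulrBl mulr1 mul1r -cstar_scalerAr -cstar_scalerAl ca.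
Qed.

Lemma sa_sq_eq0 d : selfadjoint d -> d * d = 0 -> d = 0.
Proof.
move=> sd dd; apply: nrm0_eq0; apply/eqP.
by rewrite -sqrf_eq0 -nrm_sa_sq // dd nrm0.
Qed.

(** A square root [s] of [l] commutes with [d], so [d * l * d] is the square of
    the self-adjoint element [d * s]. *)
Lemma nonneg_conj l d : cstar_nonneg l -> selfadjoint d -> d * l = l * d ->
  cstar_nonneg (d * l * d).
Proof.
move=> pl sd dl; have [s [[ss _] sE sc]] := sqrt_exists pl.
have ds := sc _ dl; have -> : d * l * d = (d * s) * (d * s).
  by rewrite -sE {2}ds !mulrA.
by apply: nonneg_sq; exact: saM.
Qed.

(** With [d = l - b], the nonnegative elements [d * l * d] and [d * b * d] add
    up to [d * (l + b) * d = 0], so both vanish, and so does their difference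
    [d ^+ 3]. *)
Lemma sqrt_unique l b : cstar_nonneg l -> cstar_nonneg b -> l * b = b * l ->
  l * l = b * b -> l = b.
Proof.
move=> pl pb lb ll; have [sl _] := pl; have [sb _] := pb.
pose d := l - b; have sd : selfadjoint d by exact: saB.
have dl : d * l = l * d by rewrite mulrBl mulrBr lb.
have db : d * b = b * d by rewrite mulrBl mulrBr lb.
have pdl := nonneg_conj pl sd dl; have pdb := nonneg_conj pb sd db.
have d0 : d * (l + b) = 0.
  by rewrite mulrDr /d !mulrBl lb ll addrA subrK subrr.
have s0 : d * l * d + d * b * d = 0 by rewrite -mulrDl -mulrDr d0 mul0r.
have dld : d * l * d = 0.
  by apply: nonneg_antisym => //; rewrite (_ : - _ = d * b * d) //; apply/eqP;
     rewrite eqr_oppLR -addr_eq0 s0.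
have dbd : d * b * d = 0 by rewrite dld add0r in s0.
apply/eqP; rewrite -subr_eq0 -/d; apply/eqP.
apply: sa_sq_eq0 => //; apply: sa_sq_eq0; first exact: saM.
have ddd : d * d * d = 0.
  have dd : d * d = d * l - d * b by exact: mulrBr.
  by rewrite dd mulrBl dld dbd subr0.
by rewrite mulrA ddd mul0r.
Qed.

Lemma cstar_sqrtP a : cstar_nonneg a ->
  [/\ cstar_nonneg (cstar_sqrt a), cstar_sqrt a * cstar_sqrt a = a &
    forall c, c * a = a * c -> c * cstar_sqrt a = cstar_sqrt a * c].
Proof.
move=> pa; have [b [pb bb bc]] := sqrt_exists pa.
have [pl ll] : [set b | cstar_nonneg b /\ b * b = a] (cstar_sqrt a).
  by apply: xgetPex; exists b.
move: pl ll; set l := cstar_sqrt a => pl ll.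
split=> // c ca; have -> : l = b; last exact: bc.
apply: sqrt_unique => //; last by rewrite ll bb.
by apply: bc; rewrite -ll mulrA.
Qed.

(** [c * star c] and [star c * c] have the same nonzero spectrum. *)
Lemma nonneg_star_mul_of_mul_star c : cstar_nonneg (c * star c) ->
  cstar_nonneg (star c * c).
Proof.
move=> pc; apply: nonneg_of_invertible; first by rewrite /selfadjoint starM starK.
move=> t t0; have [v iv] := nonneg_invertible pc t0.
have tc0 : t%:C != 0 :> R[i] by rewrite fmorph_eq0 gt_eqF.
have e x y : x * y + t%:C *: (1 : B) = t%:C *: (1 - (- (t^-1%:C *: x)) * y).
  rewrite mulNr opprK scalerDr -cstar_scalerAl scalerA -rmorphM mulfV ?gt_eqF //.
  by rewrite rmorph1 scale1r addrC.
rewrite e in iv.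
have [w iw] : invertible (1 - (- (t^-1%:C *: c)) * star c).
  by apply: (invertibleZ tc0); exists v.
rewrite e; exists ((t%:C)^-1 *: (1 + star c * w * (- (t^-1%:C *: c)))).
apply: isinvZ => //; rewrite (_ : - _ * c = star c * (- (t^-1%:C *: c))).
  exact: isinv_swap.
by rewrite mulNr mulrN -cstar_scalerAl -cstar_scalerAr.
Qed.

(** [star c * c + c * star c] is half the sum of the squares of the
    self-adjoint elements [c + star c] and [i (star c - c)].  So if
    [star c * c] is nonpositive, then [c * star c] is nonnegative, and hence so
    is [star c * c]. *)
Lemma star_mul_nonpos_eq0 c : cstar_nonneg (- (star c * c)) -> star c * c = 0.
Proof.
move=> pN; apply: nonneg_antisym => //; apply: nonneg_star_mul_of_mul_star.
pose p := c + star c; pose q := 'i%C *: (star c - c).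
have sp : selfadjoint p by rewrite /selfadjoint starD starK addrC.
have sq : selfadjoint q.
  rewrite /selfadjoint starZ starB starK -opprB scalerN -scaleNr; congr (_ *: _).
  by apply/eqP; rewrite eq_complex /= oppr0 opprK !eqxx.
have pq := nonnegD (nonneg_sq sp) (nonneg_sq sq).
have half : 0 <= 2^-1 :> R by lra.
have := nonnegD (nonnegZ half pq) pN.
suff -> : 2^-1%:C *: (p * p + q * q) - star c * c = c * star c by [].
have -> : p * p + q * q = (c * star c + star c * c) + (c * star c + star c * c).
  rewrite /q -cstar_scalerAl -cstar_scalerAr scalerA -(expr2 'i%C) sqr_i scaleN1r.
  rewrite /p; set e := star c.
  have -> : (c + e) * (c + e) = (c * e + e * c) + (c * c + e * e).
    by rewrite mulrDl !mulrDr [c * c + c * e]addrC addrACA.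
  have -> : (e - c) * (e - c) = - (c * e + e * c) + (c * c + e * e).
    rewrite mulrBl !mulrBr opprB addrACA -opprD [RHS]addrC.
    by rewrite [e * e + c * c]addrC [e * c + c * e]addrC.
  by rewrite opprD opprK addrACA subrr addr0.
rewrite scalerDr -scalerDl -rmorphD /= (_ : 2^-1 + 2^-1 = 1) ?rmorph1 ?scale1r; last lra.
by rewrite addrK.
Qed.

(** Kaplansky's theorem.  For [y = star x * x], [s] the root of [y * y] and
    [g = s - y], twice the negative part of [y], one has [y * g = - (s * g)];
    therefore [star (x * g) * (x * g) = - (g * s * g)] is nonpositive, which
    forces [x * g = 0], then [g = 0], and [y = s]. *)
Lemma nonneg_star_mul x : cstar_nonneg (star x * x).
Proof.
set y := star x * x; have sy : selfadjoint y by rewrite /selfadjoint starM starK.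
have [ps ss sc] := cstar_sqrtP (nonneg_sq sy).
set s := cstar_sqrt (y * y) in ps ss sc.
have ys : y * s = s * y by apply: sc; rewrite mulrA.
have [sas _] := ps; pose g := s - y; have sg : selfadjoint g by exact: saB.
have yg : y * g = - (s * g) by rewrite !mulrBr ss ys opprB.
have gs : g * s = s * g by rewrite mulrBl mulrBr ys.
have cc : star (x * g) * (x * g) = - (g * s * g).
  by rewrite starM sg -!mulrA (mulrA (star x)) -/y yg mulrN mulrA.
have xg0 : star (x * g) * (x * g) = 0.
  by apply: star_mul_nonpos_eq0; rewrite cc opprK; exact: nonneg_conj.
have xg : x * g = 0.
  by apply: nrm0_eq0; apply/eqP; rewrite -sqrf_eq0 -nrm_star_sq xg0 nrm0.
have yg0 : y * g = 0 by rewrite /y -mulrA xg mulr0.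
have sg0 : s * g = 0 by apply: oppr_inj; rewrite -yg yg0 oppr0.
have g0 : g = 0 by apply: sa_sq_eq0 => //; rewrite {1}/g mulrBl sg0 yg0 subr0.
by have -> : y = s by apply/eqP; rewrite eq_sym -subr_eq0 -/g g0.
Qed.

End SquareRoot.

(** * The norm of matrices is equivalent to the entrywise norms *)

Section MatrixNorm.
Context {R : realType} {B : cstarType R}.
Implicit Types (x y a b u v w : B).

Lemma cv_norm_sqr n (x : 'cV[B]_n) : cv_norm x ^+ 2 = nrm (cv_inner x x).
Proof. by rewrite sqr_sqrtr // nrm_ge0. Qed.

Lemma cv_norm_ge0 n (x : 'cV[B]_n) : 0 <= cv_norm x.
Proof. exact: sqrtr_ge0. Qed.

(** This is where the nonnegativity of [star x * x] enters: dropping the other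
    terms of the inner product decreases the norm. *)
Lemma nrm_le_cv_norm n (x : 'cV[B]_n) i : nrm (x i 0) <= cv_norm x.
Proof.
rewrite -(@ler_pXn2r _ 2) ?nnegrE ?nrm_ge0 ?cv_norm_ge0 // cv_norm_sqr.
rewrite -nrm_star_sq /cv_inner (bigD1 i) //=; apply: nonneg_norm_leD.
  exact: nonneg_star_mul.
apply: (big_ind (fun b : B => cstar_nonneg b)).
- exact: nonneg0.
- exact: nonnegD.
- by move=> j _; exact: nonneg_star_mul.
Qed.

Lemma nrm_sum (I : finType) (P : pred I) (F : I -> B) :
  nrm (\sum_(i | P i) F i) <= \sum_(i | P i) nrm (F i).
Proof.
apply: (big_ind2 (fun (b : B) (r : R) => nrm b <= r)) => //.
  by rewrite nrm0.
by move=> b r c s br cs; apply: le_trans (nrmD _ _) _; exact: lerD.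
Qed.

Lemma cv_norm_le_sum n (x : 'cV[B]_n) : cv_norm x <= \sum_i nrm (x i 0).
Proof.
set S := \sum_i _; have S0 : 0 <= S by apply: sumr_ge0 => i _; exact: nrm_ge0.
rewrite -(@ler_pXn2r _ 2) ?nnegrE ?cv_norm_ge0 // cv_norm_sqr expr2 {1}/S mulr_suml.
apply: le_trans (nrm_sum _ _) _; apply: ler_sum => i _.
rewrite nrm_star_sq expr2 ler_wpM2l ?nrm_ge0 // /S (bigD1 i) //= lerDl.
by apply: sumr_ge0 => j _; exact: nrm_ge0.
Qed.

(** This bounds the set whose supremum is [mx_cnorm T]; on an unbounded set
    [sup] is a default value. *)
Lemma cv_norm_mulmx_le n (T : 'M[B]_n) (x : 'cV[B]_n) : cv_norm x <= 1 ->
  cv_norm (T *m x) <= \sum_i \sum_j nrm (T i j).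
Proof.
move=> x1; apply: le_trans (cv_norm_le_sum _) _; apply: ler_sum => i _.
rewrite mxE; apply: le_trans (nrm_sum _ _) _; apply: ler_sum => j _.
apply: le_trans (nrmM _ _) _; rewrite ler_piMr ?nrm_ge0 //.
exact: le_trans (nrm_le_cv_norm _ _) x1.
Qed.

Lemma mx_cnorm_le n (T : 'M[B]_n) : mx_cnorm T <= \sum_i \sum_j nrm (T i j).
Proof.
apply: ge_sup.
  exists (cv_norm (T *m 0)); exists 0 => //=.
  rewrite /cv_norm /cv_inner big1 => [|i _]; last by rewrite mxE mulr0.
  by rewrite normr0 sqrtr0 ler01.
by move=> _ [x x1 <-]; exact: cv_norm_mulmx_le.
Qed.

Lemma nrm_le_mx_cnorm n (T : 'M[B]_n) i j : nrm (T i j) <= mx_cnorm T.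
Proof.
pose e : 'cV[B]_n := \col_k (k == j)%:R.
have e1 : cv_norm e <= 1.
  apply: le_trans (cv_norm_le_sum _) _.
  rewrite (bigD1 j) //= big1 => [|k kj]; last by rewrite mxE (negPf kj) nrm0.
  by rewrite mxE eqxx addr0 nrm1_le1.
have Te : (T *m e) i 0 = T i j.
  rewrite mxE (bigD1 j) //= big1 => [|k kj]; last by rewrite mxE (negPf kj) mulr0.
  by rewrite mxE eqxx mulr1 addr0.
rewrite -Te; apply: le_trans (nrm_le_cv_norm _ _) _.
apply: ub_le_sup; last by exists e.
exists (\sum_i \sum_j nrm (T i j)) => _ [x x1 <-]; exact: cv_norm_mulmx_le.
Qed.

(** Closure for the C*-norm of matrices is entrywise closure. *)
Lemma hm_closureP n (M : set 'M[B]_n) (X : 'M[B]_n) :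
  hm_closure (@mx_cnorm R B n) M X <->
  forall e, 0 < e -> exists2 Y, M Y & forall i j, nrm (X i j - Y i j) < e.
Proof.
split=> cX e e0.
  have [Y MY XY] := cX e e0; exists Y => // i j.
  by apply: le_lt_trans XY; have := nrm_le_mx_cnorm (X - Y) i j; rewrite !mxE.
have n0 : 0 < (n%:R * n%:R + 1 : R).
  by rewrite ltr_pwDr // mulr_ge0 // ler0n.
have [Y MY XY] := cX _ (divr_gt0 e0 n0); exists Y => //.
apply: le_lt_trans (mx_cnorm_le _) _.
apply: (@le_lt_trans _ _ (\sum_(i < n) \sum_(j < n) e / (n%:R * n%:R + 1))).
  by apply: ler_sum => i _; apply: ler_sum => j _; have := XY i j; rewrite !mxE => /ltW.
rewrite !sumr_const card_ord -mulrnA -[_ *+ (n * n)]mulr_natr natrM -mulrA gtr_pMr //.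
by rewrite mulrC ltr_pdivrMr // mul1r ltrDl.
Qed.

End MatrixNorm.

(** * Ranges of matrices with a single nonzero entry *)

Section SingleEntry.
Context {R : realType} {B : cstarType R}.
Implicit Types (x y a b u v w : B).

Definition range_closure b : set B :=
  [set u | forall e : R, 0 < e -> exists y, nrm (u - b * y) < e].

Lemma closure_rangeE b : closure (op_range b) = range_closure b.
Proof.
apply/seteqP; split=> [u cu e e0|u cu U].
  have [|_ [[y _ <-]]] := cu (ball u (e%:C : R[i])).
    by apply: nbhsx_ballx; rewrite ltcR.
  by rewrite -ball_normE /= nrmE ltcR => uy; exists y.
move=> /nbhs_ballP[e /= e0 eU].
have eE : e = (complex.Re e)%:C by rewrite RRe_real // gtr0_real.
have [|y uy] := cu (complex.Re e); first by rewrite -ltcR -eE.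
exists (b * y); split; first by exists y.
by apply: eU; rewrite -ball_normE /= nrmE eE ltcR.
Qed.

Lemma range_closureM b u x : range_closure b u -> range_closure b (u * x).
Proof.
move=> bu e e0; have x0 : 0 < nrm x + 1 by have := nrm_ge0 x; lra.
have [y uy] := bu _ (divr_gt0 e0 x0); exists (y * x).
rewrite mulrA -mulrBl; apply: le_lt_trans (nrmM _ _) _.
move: uy; rewrite ltr_pdivlMr //; have := nrm_ge0 (u - b * y); nra.
Qed.

Lemma range_closure_trans a b u : range_closure a b -> range_closure b u ->
  range_closure a u.
Proof.
move=> ab bu e e0; have e2 : 0 < e / 2 by lra.
have [y uy] := bu _ e2; have [w yw] := range_closureM y ab e2.
by exists w; have := nrm_tri u (b * y) (a * w); lra.
Qed.

(** The decomposition of [B] into the closure of [b B] and its orthogonal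
    complement, [B] being a Hilbert module over itself. *)
Definition range_complemented b :=
  forall x, exists u v, [/\ range_closure b u, star b * v = 0 & x = u + v].

Definition entry_mx n (i0 j0 : 'I_n) b : 'M[B]_n :=
  \matrix_(i, j) if (i == i0) && (j == j0) then b else 0.

Lemma entry_mxM n (i0 j0 : 'I_n) b (Y : 'M[B]_n) i j :
  (entry_mx i0 j0 b * Y) i j = if i == i0 then b * Y j0 j else 0.
Proof.
rewrite mxE; have [-> | ii0] := eqVneq i i0; last first.
  by rewrite big1 // => k _; rewrite mxE (negPf ii0) mul0r.
rewrite (bigD1 j0) //= mxE !eqxx big1 ?addr0 // => k kj.
by rewrite mxE (negPf kj) andbF mul0r.
Qed.

(** Row [i0] of [entry_mx i0 j0 b * Y] is [b] times row [j0] of [Y], which is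
    arbitrary. *)
Lemma closure_entry_mx n (i0 j0 : 'I_n) b (X : 'M[B]_n) :
  hm_closure (@mx_cnorm R B n) (op_range (entry_mx i0 j0 b)) X <->
  (forall j, range_closure b (X i0 j)) /\ (forall i j, i != i0 -> X i j = 0).
Proof.
split=> [/hm_closureP cX|[cX X0]].
  split=> [j e e0|i j ii0].
    have [_ [Y _ <-] /(_ i0 j)] := cX e e0.
    by rewrite entry_mxM eqxx; exists (Y j0 j).
  apply: nrm_small_eq0 => e e0.
  have [_ [Y _ <-] /(_ i j)] := cX e e0.
  by rewrite entry_mxM (negPf ii0) subr0 => /ltW.
apply/hm_closureP => e e0.
have [y Xy] := choice (fun j => cX j e e0).
exists (entry_mx i0 j0 b * \matrix_(i, j) y j); first by eexists.
move=> i j; rewrite entry_mxM; have [->|ii0] := eqVneq i i0.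
  by rewrite mxE.
by rewrite X0 // subr0 nrm0.
Qed.

Lemma range_closure_orth b u v : range_closure b u -> star b * v = 0 ->
  star v * u = 0.
Proof.
move=> bu bv; have vb : star v * b = 0.
  by rewrite -[LHS]starK starM starK bv star0.
apply: nrm_small_eq0 => e e0.
have v0 : 0 < nrm v + 1 by have := nrm_ge0 v; lra.
have [y] := bu _ (divr_gt0 e0 v0); rewrite ltr_pdivlMr // => uy.
have -> : star v * u = star v * (u - b * y).
  by rewrite mulrBr mulrA vb mul0r subr0.
apply: le_trans (nrmM _ _) _; rewrite nrm_star.
by have := nrm_ge0 (u - b * y); nra.
Qed.

(** A decomposition of [entry_mx i0 i0 x] gives one of [x] by reading off an
    entry.  Conversely, decompositions of the entries of row [i0] assemble into
    one of the matrix; the other rows go to the orthogonal part. *)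
Lemma orth_complemented_entry_mx n (i0 j0 : 'I_n) b :
  orth_complemented (@mx_star R B n)
    (hm_closure (@mx_cnorm R B n) (op_range (entry_mx i0 j0 b))) <->
  range_complemented b.
Proof.
split=> [oc x|rc].
  have : [set: 'M[B]_n] (entry_mx i0 i0 x) by [].
  rewrite -oc => -[U cU [V oV UV]].
  have [cU0 _] := (closure_entry_mx i0 j0 b U).1 cU.
  exists (U i0 i0), (V i0 i0); split=> //; last first.
    by move/matrixP: UV => /(_ i0 i0); rewrite !mxE !eqxx.
  have /oV/matrixP/(_ i0 i0) : hm_closure (@mx_cnorm R B n)
      (op_range (entry_mx i0 j0 b)) (entry_mx i0 j0 b * entry_mx j0 i0 1).
    move=> e e0; exists (entry_mx i0 j0 b * entry_mx j0 i0 1); first by eexists.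
    rewrite subrr; apply: le_lt_trans (mx_cnorm_le _) _.
    by rewrite big1 // => i _; rewrite big1 // => j _; rewrite mxE nrm0.
  rewrite mxE (bigD1 i0) //= big1 => [|k ki]; last first.
    by rewrite entry_mxM (negPf ki) mulr0.
  rewrite entry_mxM eqxx !mxE !eqxx mulr1 addr0 => vb.
  by rewrite -[LHS]starK starM starK vb star0.
apply/seteqP; split=> // X _.
have [u hu] := choice rc; have [v huv] := choice hu.
pose U : 'M[B]_n := \matrix_(i, j) if i == i0 then u (X i0 j) else 0.
exists U.
  apply/closure_entry_mx; split=> [j|i j ii0]; rewrite mxE ?eqxx ?(negPf ii0) //.
  by have [] := huv (X i0 j).
exists (X - U); last by rewrite addrC subrK.
move=> Y /closure_entry_mx[cY Y0]; apply/matrixP => i j.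
rewrite mxE (bigD1 i0) //= big1 => [|k ki]; last by rewrite (Y0 k) ?mulr0.
rewrite !mxE eqxx addr0; have [_ bv XE] := huv (X i0 i).
by rewrite {1}XE addrC addKr; exact: range_closure_orth (cY j) bv.
Qed.

End SingleEntry.

(** * The range and the null space of a square *)

Section RangeOfRoot.
Context {R : realType} {B : cstarType R}.
Implicit Types (x y a b l u v w : B).

(** The approximants are [l * l * (l * (l * l + t ^ 2)^-1)]; they differ from
    [l] by [t ^ 2 * l * (l + i t)^-1 * (l - i t)^-1], of norm at most [2 t] by
    the resolvent bound. *)
Lemma range_closure_sq l : selfadjoint l -> range_closure (l * l) l.
Proof.
move=> sl e e0; pose t := e / 4; have t0 : 0 < t by rewrite /t; lra.
pose k : R[i] := 'i%C * t%:C.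
have imk : complex.Im k = t by rewrite /= mul0r mul1r add0r.
have imNk : complex.Im (- k) = - t by rewrite -imk; case: (k).
have [|v iv nv] := @sa_resolvent_bound _ _ l k sl; first by rewrite imk gt_eqF.
have [|w iw nw] := @sa_resolvent_bound _ _ l (- k) sl.
  by rewrite imNk oppr_eq0 gt_eqF.
rewrite imk gtr0_norm // in nv; rewrite imNk normrN gtr0_norm // in nw.
rewrite scaleNr opprK in iw.
have [_ iW] := isinvM iv iw; rewrite sa_imag_prod // in iW.
have lw : nrm (l * w) <= 2.
  have [_ iw2] := iw.
  have -> : l * w = 1 - k *: w.
    by rewrite -iw2 mulrDl mul_scalarl addrK.
  apply: le_trans (nrmB _ _) _; rewrite nrmZ Re_norm_imag gtr0_norm //.
  have := @nrm1_le1 R B; have : t * nrm w <= 1.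
    by rewrite mulrC -ler_pdivlMr // mul1r.
  by move: (t * _) => p; lra.
exists (l * (w * v)).
have -> : l - l * l * (l * (w * v)) = (t ^+ 2)%:C *: (l * w * v).
  have e1 : (t ^+ 2)%:C *: (w * v) = 1 - l * l * (w * v).
    by rewrite -iW mulrDl mul_scalarl addrAC subrr add0r.
  rewrite -(mulrA l w) cstar_scalerAr e1 mulrBr mulr1; congr (_ - _).
  by rewrite !mulrA.
rewrite nrmZr ger0_norm ?sqr_ge0 //.
have h1 : t * nrm v <= 1 by rewrite mulrC -ler_pdivlMr // mul1r.
have h2 : nrm (l * w * v) <= 2 * nrm v.
  by apply: le_trans (nrmM _ _) _; rewrite ler_wpM2r ?nrm_ge0.
have h3 : t ^+ 2 * nrm (l * w * v) <= t * 2.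
  apply: le_trans (_ : t ^+ 2 * (2 * nrm v) <= _).
    by rewrite ler_wpM2l ?sqr_ge0.
  have -> : t ^+ 2 * (2 * nrm v) = t * 2 * (t * nrm v) by ring.
  by rewrite ler_piMr //; lra.
by apply: le_lt_trans h3 _; rewrite /t; lra.
Qed.

(** The closure of [l B] and the null space of [l] are right ideals, so it is
    enough to decompose [1]; both are unchanged when [l] is replaced by
    [l * l]. *)
Lemma range_complemented_sq l : selfadjoint l -> range_complemented l <->
  [set x + y | x in closure (op_range (l * l)) & y in nullspace (l * l)] 1.
Proof.
move=> sl; rewrite closure_rangeE; split=> [/(_ 1)[u [v [lu lv e]]]|].
  exists u; first exact: range_closure_trans (range_closure_sq sl) lu.
  by exists v; [rewrite /nullspace /= -mulrA -{2}sl lv mulr0|].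
case=> u lu [v lv uv] x; exists (u * x), (v * x); split.
- apply: range_closureM; apply: range_closure_trans lu.
  by move=> e e0; exists l; rewrite subrr nrm0.
- rewrite mulrA sl; suff -> : l * v = 0 by rewrite mul0r.
  apply: nrm0_eq0; apply/eqP; rewrite -sqrf_eq0 -nrm_star_sq starM sl.
  by rewrite -mulrA (mulrA l) lv mulr0 nrm0.
- by rewrite -mulrDl uv mul1r.
Qed.

Lemma range_complementedN b : range_complemented b -> range_complemented (- b).
Proof.
move=> cb x; have [u [v [bu bv ->]]] := cb x; exists u, v; split=> //.
  by move=> e /bu[y uy]; exists (- y); rewrite mulrNN.
by rewrite starN mulNr bv oppr0.
Qed.

End RangeOfRoot.

(** * Two by two matrices *)

Section TwoByTwo.
Context {R : realType} {B : cstarType R}.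
Implicit Types (a b c d : B).

Lemma mx22P (X Y : 'M[B]_2) : X 0 0 = Y 0 0 -> X 0 1 = Y 0 1 ->
  X 1 0 = Y 1 0 -> X 1 1 = Y 1 1 -> X = Y.
Proof.
move=> e00 e01 e10 e11; apply/matrixP.
have I2 (i : 'I_2) : i = 0 \/ i = 1.
  by case: i => [[|[|//]]] h; [left|right]; apply: val_inj.
by move=> i j; case: (I2 i) => ->; case: (I2 j) => ->.
Qed.

Lemma mx22M a b c d a' b' c' d' : mx22 a b c d * mx22 a' b' c' d' =
  mx22 (a * a' + b * c') (a * b' + b * d') (c * a' + d * c') (c * b' + d * d').
Proof. by apply: mx22P; rewrite !mxE !big_ord_recl big_ord0 !mxE /= addr0. Qed.

Lemma mx22_star a b c d :
  mx_star (mx22 a b c d) = mx22 (star a) (star c) (star b) (star d).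
Proof. by apply: mx22P; rewrite !mxE. Qed.

Lemma mx22N a b c d : - mx22 a b c d = mx22 (- a) (- b) (- c) (- d).
Proof. by apply: mx22P; rewrite !mxE. Qed.

Lemma mx22_1B : 1 - mx22 1 0 0 0 = mx22 0 0 0 1 :> 'M[B]_2.
Proof. by apply: mx22P; rewrite !mxE /= ?subr0 ?subrr. Qed.

Lemma mx22_entry01 b : mx22 0 b 0 0 = entry_mx 0 1 b.
Proof. by apply: mx22P; rewrite !mxE. Qed.

Lemma mx22_entry10 b : mx22 0 0 b 0 = entry_mx 1 0 b.
Proof. by apply: mx22P; rewrite !mxE. Qed.

(** Idempotence of [Q] is where the commutation of [l] with [A] is used. *)
Lemma quasi_projection_pair_mx22 (A l : B) : selfadjoint A -> selfadjoint l ->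
  l * A = A * l -> l * l = A * A - A ->
  quasi_projection_pair (@mx_star R B 2) (mx22 1 0 0 0)
    (mx22 A (- l) l (1 - A)).
Proof.
move=> sA sl lA ll.
have sB1 : star (1 - A) = 1 - A by rewrite starB star1 sA.
have z := (mulr0, mul0r, mulr1, mul1r, addr0, add0r).
split; rewrite ?mx22_1B ?mx22_star ?starN ?star0 ?star1 ?sA ?sl ?sB1 ?mx22M
  ?mx22N ?z ?oppr0 ?opprK //.
  by split; rewrite ?mx22_star ?mx22M ?star0 ?star1 ?z.
congr mx22.
- by rewrite mulNr ll opprB addrC subrK.
- by rewrite mulrN mulNr mulrBr mulr1 lA opprB addKr.
- by rewrite mulrBl mul1r lA addrC subrK.
- by rewrite mulrN ll opprB mulrBr mulr1 mulrBl mul1r addrC subrK.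
Qed.

End TwoByTwo.

Unset Implicit Arguments.
Set Strict Implicit.
Set Printing Implicit Defensive.
Local Close Scope complex_scope.

Theorem theorem4p5 (R : realType) (B : cstarType R) (A : B)
    (A_sa : selfadjoint A) (A_ge : cstar_nonneg (A ^+ 2 - A)) :
  let l := cstar_sqrt (A ^+ 2 - A) in
  let P := mx22 1 0 0 0 in
  let Q := mx22 A (- l) l (1 - A) in
  harmonious (@mx_star R B 2) (@mx_cnorm R B 2) P Q <->
  [set x + y | x in closure (op_range (A ^+ 2 - A))
             & y in nullspace (A ^+ 2 - A)] (1 : B).
Proof.
move=> l P Q; have [[sl _] ll lc] := cstar_sqrtP A_ge.
rewrite -/l in sl ll lc.
have lA : l * A = A * l.
  by apply/esym/lc; rewrite mulrBr mulrBl expr2 mulrA.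
have z := (mulr0, mul0r, mulr1, mul1r, addr0, add0r).
have E12 : P * Q * (1 - P) = entry_mx 0 1 (- l).
  by rewrite /P /Q mx22_1B !mx22M !z mx22_entry01.
have E21 : (1 - P) * Q * P = entry_mx 1 0 l.
  by rewrite /P /Q mx22_1B !mx22M !z mx22_entry10.
rewrite /harmonious E12 E21 -{1 2}ll.
split=> [[_ _ /orth_complemented_entry_mx]|].
  by move=> /(range_complemented_sq sl).
move=> /(range_complemented_sq sl) rl.
split; first by apply: quasi_projection_pair_mx22 => //; rewrite ll expr2.
  by apply/orth_complemented_entry_mx/range_complementedN.
exact/orth_complemented_entry_mx.
Qed.
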